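(* Let $\mathcal{A} = \mathbb{R}[k]/\langle p(k)\rangle$, where $p(k) \in \mathbb{R}[k]$ is depressed and monic. Then for every $\theta \in \mathbb{R}$, $F(e^{k\theta}) = 1$.
   Context: A monic polynomial of degree $n$ is depressed if its coefficient of degree $n-1$ is zero, i.e. $p(k) = k^n + c_{n-2}k^{n-2}+\dots+c_1k+c_0$. In $\mathcal{A}$, $k$ denotes the class of the indeterminate, and $\beta = \{1,k,\dots,k^{n-1}\}$ is the basis used. For $z\in\mathcal{A}$, $M_\beta(z)$ is the matrix with respect to $\beta$ of the left-multiplication map $x \mapsto zx$ on $\mathcal{A}$, and the Pythagorean function is $F(z) = \det(M_\beta(z))$. The exponential is $e^z = \sum_{m=0}^\infty z^m/m!$ for $z\in\mathcal{A}$. *)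

(* Defs.v *)
From HB Require Import structures.
From mathcomp Require Import all_boot all_order all_algebra.
From mathcomp Require Import all_classical all_reals all_analysis.

Set Implicit Arguments.
Unset Strict Implicit.
Unset Printing Implicit Defensive.

Import Order.TTheory GRing.Theory Num.Theory.
Import numFieldNormedType.Exports.

Local Open Scope classical_set_scope.
Local Open Scope ring_scope.

(* [{poly %/ p}] is R[X]/(p) only when [p] is monic of positive degree; on any
   other [p] the library quotients by ['X] instead (see [mk_monic]). A
   polynomial of degree n has size n + 1, so the coefficient of degree n - 1 is
   the one of index [(size p).-2]. *)
Definition depressed (R : nzRingType) (p : {poly R}) : Prop :=
  [/\ (1 < size p)%N, p \is monic & p`_(size p).-2 = 0].

Section QuotientAlgebra.
Context {R : realType} (p : {poly R}).

Definition qdim : nat := (size (mk_monic p)).-1.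

HB.instance Definition _ := Vector.copy {poly %/ p} {poly_qdim R}.

Definition powers : qdim.-tuple {poly %/ p} := [tuple 'qX ^+ i | i < qdim].

Lemma powersE : powers = npolyX R qdim.
Proof.
apply: eq_from_tnth => i; rewrite !tnth_map !tnth_ord_tuple; apply: val_inj.
have si : (size ('X^i : {poly R}) < size (mk_monic p))%N.
  rewrite size_polyXn; have := ltn_ord i; rewrite {2}/qdim.
  by case: (size (mk_monic p)).
rewrite -[RHS]/(polyn _) npolypK ?size_polyXn //.
by rewrite /qpolyX -rmorphXn /= Pdiv.CommonRing.rmodp_small.
Qed.

Lemma powers_basis : basis_of {: {poly %/ p}} powers.
Proof. by rewrite powersE; exact: npolyX_full. Qed.

(* The matrix acts on column vectors: column j holds the coordinates of
   [z * k ^+ j]. *)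
Definition lmul_mx (z : {poly %/ p}) : 'M[R]_qdim :=
  \matrix_(i, j) coord powers i (z * powers`_j).

Definition pythag (z : {poly %/ p}) : R := \det (lmul_mx z).

(* The library puts no topology on [{poly %/ p}]; all norms on this
   finite-dimensional space are equivalent, and the one used here is the largest
   absolute value of a coordinate in the basis [powers]. *)
Definition qnorm (z : {poly %/ p}) : R := `|\row_i coord powers i z|.

Lemma qnormD x y : qnorm (x + y) <= qnorm x + qnorm y.
Proof.
rewrite /qnorm; apply: le_trans (ler_normD _ _); rewrite le_eqVlt; apply/orP.
by left; apply/eqP; congr (`|_|); apply/rowP => i; rewrite !mxE linearD.
Qed.

Lemma qnormZ (l : R) x : qnorm (l *: x) = `|l| * qnorm x.
Proof.
rewrite /qnorm -normrZ; congr (`|_|); apply/rowP => i.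
by rewrite !mxE linearZ.
Qed.

Lemma qnorm0_eq0 x : qnorm x = 0 -> x = 0.
Proof.
move=> /normr0_eq0/rowP x0; rewrite (coord_basis powers_basis (memvf x)).
by rewrite big1 // => i _; have := x0 i; rewrite !mxE => ->; rewrite scale0r.
Qed.

HB.instance Definition _ :=
  Lmodule_isNormed.Build R {poly %/ p} qnormD qnormZ qnorm0_eq0.

Definition qexp_coeff (z : {poly %/ p}) : {poly %/ p} ^nat :=
  [sequence (m`!%:R)^-1 *: z ^+ m]_m.

Definition qexp (z : {poly %/ p}) : {poly %/ p} := limn (series (qexp_coeff z)).

Lemma qnormE (z : {poly %/ p}) : `|z| = `|\row_i coord powers i z|.
Proof. by []. Qed.

Lemma ler_coord_qnorm (z : {poly %/ p}) i : `|coord powers i z| <= `|z|.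
Proof.
rewrite qnormE [leRHS]/Num.norm /= mx_normrE.
by apply: le_trans (le_bigmax _ _ (ord0, i)); rewrite /= mxE.
Qed.

Lemma qnormM_le (z w : {poly %/ p}) :
  `|z * w| <= (\sum_(j < qdim) `|z * powers`_j|) * `|w|.
Proof.
rewrite {1}(coord_basis powers_basis (memvf w)) mulr_sumr mulr_suml.
apply: le_trans (ler_norm_sum _ _ _) _; apply: ler_sum => j _.
by rewrite -scalerAr normrZ mulrC ler_wpM2l// ler_coord_qnorm.
Qed.

Lemma is_cvg_series_qexp_coeff (z : {poly %/ p}) :
  cvgn (series (qexp_coeff z)).
Proof.
pose K := \sum_(j < qdim) `|z * powers`_j|.
have K0 : 0 <= K by apply: sumr_ge0.
have zK m : `|z ^+ m| <= K ^+ m * `|1 : {poly %/ p}|.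
  elim: m => [|m IH]; first by rewrite !expr0 mul1r.
  by rewrite !exprS -mulrA (le_trans (qnormM_le _ _))// ler_wpM2l.
pose c i m := coord powers i (qexp_coeff z m).
have cc i : cvgn (series (c i)).
  apply: normed_cvg.
  apply: (@series_le_cvg _ _ (`|1 : {poly %/ p}| *: exp_coeff K)) => /=.
  - by move=> m; apply: normr_ge0.
  - by move=> m; rewrite mulr_ge0// divr_ge0 ?exprn_ge0.
  - move=> m; rewrite (le_trans (ler_coord_qnorm _ _))//= normrZ.
    rewrite ger0_norm ?invr_ge0// /exp_coeff /=.
    rewrite -[leRHS]/(`|1 : {poly %/ p}| * (K ^+ m / m`!%:R)) mulrA mulrC.
    by rewrite ler_wpM2r ?invr_ge0// mulrC.
  - by apply: is_cvg_seriesZ; apply: is_cvg_series_exp_coeff.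
rewrite (_ : series _ =
    fun n => \sum_(i < qdim) series (c i) n *: powers`_i); last first.
  apply/funext => n; rewrite [LHS](coord_basis powers_basis (memvf _)).
  by apply: eq_bigr => i _; congr (_ *: _); rewrite /series/= linear_sum.
apply: (cvgP (\sum_(i < qdim) limn (series (c i)) *: powers`_i)).
apply: cvg_big => [|i _]; last exact: cvgZr_tmp (cc i).
exact: add_continuous.
Qed.

End QuotientAlgebra.

(* Main.v *)
Require Import Defs.
From mathcomp Require Import all_boot all_order all_algebra.
From mathcomp Require Import ring.
From mathcomp Require Import all_classical all_reals all_analysis.

Import Order.TTheory GRing.Theory Num.Theory.
Import numFieldNormedType.Exports.
Local Open Scope classical_set_scope.
Local Open Scope ring_scope.

(* [qexp z] is the limit of [(1 + z / n) ^+ n], and [pythag] is multiplicative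
   and continuous, so for [z = theta *: 'qX] its value is the limit of
   [pythag (1 + (theta / n) *: 'qX) ^+ n]. Multiplication by ['qX] is given by
   the companion matrix of [p], whose trace is 0 because [p] is depressed; hence
   [pythag (1 + t *: 'qX) = 1 + O(t ^+ 2)] and the limit is 1. *)

(** * Real estimates for powers of factors close to 1 *)

Lemma bernoulli_1B (R : realDomainType) (x : R) n :
  0 <= x <= 1 -> 1 - n%:R * x <= (1 - x) ^+ n.
Proof.
move=> /andP[x0 x1]; elim: n => [|n IH]; first by rewrite mul0r subr0 expr0.
rewrite exprS; apply: le_trans (ler_wpM2l _ IH); last by rewrite subr_ge0.
rewrite -subr_ge0 (_ : _ - _ = n%:R * x ^+ 2) ?mulr_ge0 ?sqr_ge0//.
by rewrite -natr1; ring.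
Qed.

(* [1 + y >= expR y * (1 - y ^+ 2)], raised to the power [n]. *)
Lemma expR_sub_exprn1D_le (R : realType) (y : R) n : 0 <= y ->
  expR (n%:R * y) - (1 + y) ^+ n <= expR (n%:R * y) * (n%:R * y ^+ 2).
Proof.
move=> y0; rewrite lerBlDr -lerBlDl -[X in X - _]mulr1 -mulrBr.
have y2 := sqr_ge0 y.
(* Bernoulli's inequality needs [y ^+ 2 <= 1]. Beyond that, [1 - n%:R * y ^+ 2] is nonpositive as
   soon as [n > 0]. *)
have [y1|y1] := lerP (y ^+ 2) 1; last first.
  case: n => [|n]; first by rewrite !mul0r expR0 expr0 mul1r subr0.
  apply: (@le_trans _ _ 0); last by rewrite exprn_ge0// addr_ge0.
  rewrite mulr_ge0_le0 ?expR_ge0// subr_le0 -natr1 mulrDl mul1r.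
  by rewrite (le_trans (ltW y1))// lerDr mulr_ge0.
apply: (@le_trans _ _ (expR (n%:R * y) * (1 - y ^+ 2) ^+ n)).
  by rewrite ler_wpM2l ?expR_ge0// bernoulli_1B ?y2.
rewrite expRM_natl -exprMn lerXn2r ?nnegrE ?mulr_ge0 ?expR_ge0 ?subr_ge0//.
  by rewrite addr_ge0.
(* After division by [expR y], factoring [1 - y ^+ 2] leaves [1 - y <= expR (- y)]. *)
rewrite mulrC -ler_pdivlMr ?expR_gt0// -expRN.
rewrite (_ : 1 - y ^+ 2 = (1 + y) * (1 - y)); last by ring.
by rewrite ler_wpM2l ?addr_ge0 ?expR_ge1Dx.
Qed.

Lemma ffact_leq_expn n m : (n ^_ m <= n ^ m)%N.
Proof.
elim: m => [|m IH]; first by rewrite ffactn0.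
by rewrite ffactnSr expnSr leq_mul// leq_subr.
Qed.

Lemma bin_div_expn_le_invfact (R : realFieldType) n i :
  'C(n.+1, i)%:R / n.+1%:R ^+ i <= i`!%:R^-1 :> R.
Proof.
rewrite ler_pdivrMr ?exprn_gt0 ?ltr0n// ler_pdivlMl ?ltr0n ?fact_gt0//.
by rewrite -natrX -natrM ler_nat mulnC bin_ffact ffact_leq_expn.
Qed.

(** Stated for a general algebra because it serves twice: for [z] in the quotient and for a real [K]
    dominating its powers. The coefficients on the right are nonnegative by
    [bin_div_expn_le_invfact], so the second instance bounds the first. *)
Lemma sum_exp_sub_exprn1D (R : realType) (A : algType R) (z : A) n :
  \sum_(0 <= i < n.+2) i`!%:R^-1 *: z ^+ i - (1 + n.+1%:R^-1 *: z) ^+ n.+1 =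
  \sum_(0 <= i < n.+2)
    (i`!%:R^-1 - 'C(n.+1, i)%:R / n.+1%:R ^+ i) *: z ^+ i.
Proof.
rewrite exprDn_comm; last exact: commr_sym (commr1 _).
rewrite -(big_mkord xpredT (fun i => 1 ^+ (n.+1 - i) *
  (n.+1%:R^-1 *: z) ^+ i *+ 'C(n.+1, i))) -sumrB; apply: eq_bigr => i _.
rewrite scalerBl expr1n mul1r exprZn exprVn; congr (_ - _).
by rewrite -scaler_nat scalerA.
Qed.

(** An error of order [harmonic n ^+ 2] in each of [n.+1] factors adds up to order [harmonic n]
    only. Bernoulli's inequality gives the lower bound, [1 + x <= expR x] the upper one. *)
Lemma cvg_exprn_near1 (R : realType) (u : R ^nat) (C : R) : 0 <= C ->
  (\forall n \near \oo, `|u n - 1| <= C * harmonic n ^+ 2) ->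
  u n ^+ n.+1 @[n --> \oo] --> (1 : R).
Proof.
move=> C0 uC.
have Ch : (C * harmonic n) @[n --> \oo] --> (0 : R).
  by rewrite -[X in _ --> X](mulr0 C); apply: cvgMl_tmp; exact: cvg_harmonic.
apply: (@squeeze_cvgr _ _ _ _ (fun n => 1 - C * harmonic n)
   (fun n => expR (C * harmonic n))).
- near=> n.
  have h0 : 0 < harmonic n :> R by rewrite harmonic_gt0.
  have Cn : C * harmonic n <= 1.
    near: n; exact: (cvgr_le _ Ch).
  have nh : n.+1%:R * harmonic n = 1 :> R by rewrite /harmonic mulfV.
  have d0 : 0 <= C * harmonic n ^+ 2 by rewrite mulr_ge0 ?sqr_ge0.
  have d1 : C * harmonic n ^+ 2 <= 1.
    rewrite expr2 mulrA (le_trans _ Cn)// ler_piMr ?mulr_ge0 ?(ltW h0)//.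
    by rewrite /harmonic/= invf_le1 ?ler1n ?ltr0n.
  have nd : n.+1%:R * (C * harmonic n ^+ 2) = C * harmonic n.
    by rewrite -[RHS]mulr1 -[in RHS]nh; ring.
  have : `|u n - 1| <= C * harmonic n ^+ 2 by near: n.
  rewrite ler_distl => /andP[ul ur].
  have u0 : 0 <= u n by rewrite (le_trans _ ul)// subr_ge0.
  apply/andP; split.
    rewrite -nd (le_trans (@bernoulli_1B _ _ n.+1 _)) ?d0//.
    by rewrite lerXn2r ?nnegrE ?subr_ge0.
  rewrite -nd expRM_natl lerXn2r ?nnegrE ?expR_ge0//.
  by rewrite (le_trans ur)// expR_ge1Dx.
- rewrite -[X in _ --> X]subr0; apply: cvgB => //; exact: cvg_cst.
- rewrite -expR0; apply: continuous_cvg => //; exact: continuous_expR.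
Unshelve. all: by end_near. Qed.

(** * Determinants near the identity matrix *)

(** For [t != 0] the determinant is [t ^+ n] times the value of [char_poly (- A)] at [t^-1], which
    reverses the coefficients. *)
Lemma det_1DZ (F : fieldType) n (A : 'M[F]_n) t :
  \det (1%:M + t *: A) = \sum_(i < n.+1) (char_poly (- A))`_(n - i) * t ^+ i.
Proof.
have lead : (char_poly (- A))`_n = 1.
  by have /monicP := char_poly_monic (- A); rewrite lead_coefE size_char_poly.
have [->|t0] := eqVneq t 0.
  rewrite scale0r addr0 det1 big_ord_recl/= subn0 lead expr0 mulr1 big1 ?addr0//.
  by move=> i _; rewrite expr0n mulr0.
have -> : 1%:M + t *: A = t *: (t^-1%:M - - A).
  by rewrite opprK scalerDr scale_scalar_mx mulfV.
have det_horner : \det (t^-1%:M - - A) = (char_poly (- A)).[t^-1].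
  rewrite -horner_evalE -det_map_mx; congr (\det _); apply/matrixP => i j.
  by rewrite !mxE /= /horner_eval !hornerE hornerMn hornerX.
rewrite detZ det_horner horner_coef size_char_poly mulr_sumr.
rewrite (reindex_inj rev_ord_inj); apply: eq_bigr => /= i _.
have ni : (i <= n)%N by rewrite -ltnS.
rewrite subSS mulrCA; congr (_ * _).
by rewrite exprVn -exprB ?leq_subr ?unitfE// subKn.
Qed.

Lemma det_1DZ_near1 (R : realFieldType) n (A : 'M[R]_n) : \tr A = 0 ->
  exists2 C, 0 <= C &
    forall t, `|t| <= 1 -> `|\det (1%:M + t *: A) - 1| <= C * t ^+ 2.
Proof.
case: n A => [|n] A tr0.
  by exists 0 => // t _; rewrite det_mx00 subrr normr0 mul0r.
(* The terms of degree 0 and 1 in [t] are the leading coefficient 1 and the vanishing trace; [C]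
   collects the others, where [t ^+ 2] factors out. *)
exists (\sum_(i < n) `|(char_poly (- A))`_(n.+1 - i.+2)|); first exact: sumr_ge0.
move=> t t1; rewrite det_1DZ !big_ord_recl /= /bump/=.
have := char_poly_monic (- A); rewrite monicE lead_coefE size_char_poly.
rewrite subn0 => /eqP ->.
have := @char_poly_trace _ _ (- A) isT; rewrite subn1 => ->.
have -> : \tr (- A) = 0 by rewrite -scaleN1r mxtraceZ tr0 mulr0.
rewrite oppr0 mul0r add0r mulr1 addrAC subrr add0r mulr_suml.
apply: le_trans (ler_norm_sum _ _ _) _; apply: ler_sum => i _.
rewrite normrM ler_wpM2l// normrX !add1n -[i.+2]addn2 exprD.
by rewrite real_normK ?num_real// ler_piMl ?sqr_ge0// exprn_ile1.
Qed.

(** * The Pythagorean function and the exponential on the quotient algebra *)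

Section QuotientAlgebra.
Context {R : realType} {p : {poly R}}.
Local Notation A := {poly %/ p}.
Implicit Types z w : A.

Lemma coord_powersE i z : coord (powers p) i z = z`_i.
Proof. by rewrite powersE npolyX_coords. Qed.

Lemma nth_powers (i : 'I_(qdim p)) : (powers p)`_i = 'qX ^+ i.
Proof. by rewrite -tnth_nth tnth_map tnth_ord_tuple. Qed.

Lemma lmul_mxM z w : lmul_mx (z * w) = lmul_mx z *m lmul_mx w.
Proof.
apply/matrixP => i j; rewrite !mxE -mulrA.
rewrite {1}(coord_basis (powers_basis p) (memvf (w * _))) mulr_sumr linear_sum.
by apply: eq_bigr => k _; rewrite !mxE -scalerAr linearZ /= mulrC.
Qed.

Lemma lmul_mx1 : lmul_mx (1 : A) = 1%:M.
Proof.
apply/matrixP => i j; rewrite !mxE mul1r coord_free 1?eq_sym//.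
exact: basis_free (powers_basis p).
Qed.

Lemma lmul_mx1DZ t z : lmul_mx (1 + t *: z) = 1%:M + t *: lmul_mx z.
Proof.
rewrite -lmul_mx1; apply/matrixP => i j; rewrite !mxE.
by rewrite mulrDl linearD -scalerAl linearZ.
Qed.

Lemma pythagX z n : pythag (z ^+ n) = pythag z ^+ n.
Proof.
elim: n => [|n IH]; first by rewrite !expr0 /pythag lmul_mx1 det1.
by rewrite !exprS {1}/pythag lmul_mxM det_mulmx -IH.
Qed.

(** The determinant is a finite sum of products of entries, and each entry depends linearly on [z]
    with a bound from [qnormM_le]. *)
Lemma cvg_pythag (u : A ^nat) z :
  u n @[n --> \oo] --> z -> pythag (u n) @[n --> \oo] --> pythag z.
Proof.
move=> uz.
have entry i j : lmul_mx (u n) i j @[n --> \oo] --> lmul_mx z i j.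
  apply/subr_cvg0/norm_cvg0P.
  have /subr_cvg0/norm_cvg0P uz0 := uz.
  pose K := \sum_(k < qdim p) `|(powers p)`_j * (powers p)`_k|.
  apply: (@squeeze_cvgr _ _ _ _ (fun=> 0) (fun n => K * `|u n - z|)).
  - near=> n; rewrite normr_ge0/= !mxE -linearB/= -mulrBl mulrC.
    by rewrite (le_trans (ler_coord_qnorm _ _))// qnormM_le.
  - exact: cvg_cst.
  - by rewrite -[X in _ --> X](mulr0 K); exact: cvgMl_tmp.
rewrite /pythag /determinant; apply: cvg_big => [|s _].
  exact: add_continuous.
apply: cvgMl_tmp; apply: cvg_big => [|i _]; first exact: mul_continuous.
exact: entry.
Unshelve. all: by end_near. Qed.

Lemma ler_qnormX z : exists2 K, 0 <= K &
  forall m, `|z ^+ m| <= `|1 : A| * K ^+ m.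
Proof.
exists (\sum_(j < qdim p) `|z * (powers p)`_j|); first exact: sumr_ge0.
elim=> [|m IH]; first by rewrite !expr0 mulr1.
rewrite !exprS mulrCA (le_trans (qnormM_le _ _))// ler_wpM2l//.
exact: sumr_ge0.
Qed.

(** The gap between the partial sum and the power is dominated, up to the factor [|1|], by the same
    gap for the real number [K], which is at most [expR K * (K ^+ 2 * harmonic n)]. *)
Lemma cvg_exprn1D_qexp z :
  (1 + n.+1%:R^-1 *: z) ^+ n.+1 @[n --> \oo] --> qexp z.
Proof.
have [K K0 zK] := ler_qnormX z.
(* The shift by 2 keeps the terms of degree at most [n.+1], exactly those of the binomial
   expansion. *)
have Sz : series (qexp_coeff z) n.+2 @[n --> \oo] --> qexp z.
  rewrite (cvg_shiftS (fun n => series _ n.+1)) (cvg_shiftS (series _)).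
  exact: is_cvg_series_qexp_coeff.
have bound0 :
    `|1 : A| * (expR K * (K ^+ 2 * harmonic n)) @[n --> \oo] --> (0 : R).
  rewrite -(mulr0 `|1 : A|) -(mulr0 (expR K)) -(mulr0 (K ^+ 2)).
  by do 3 apply: cvgMl_tmp; exact: cvg_harmonic.
pose D n := series (qexp_coeff z) n.+2 - (1 + n.+1%:R^-1 *: z) ^+ n.+1.
suff D0 : D n @[n --> \oo] --> (0 : A).
  rewrite -[X in _ --> X]subr0.
  rewrite (_ : (fun n => _) = (fun n => series (qexp_coeff z) n.+2) - D).
    exact: cvgB.
  by apply/funext => n; rewrite [RHS]/GRing.add/= /D opprB addrC subrK.
apply/norm_cvg0P; apply: (@squeeze_cvgr _ _ _ _ (fun=> 0) _ _ _ _ _ bound0).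
  near=> n; rewrite normr_ge0/= /D /series/= sum_exp_sub_exprn1D.
  apply: le_trans (ler_norm_sum _ _ _) _.
  have y0 : 0 <= n.+1%:R^-1 * K by rewrite mulr_ge0.
  have := expR_sub_exprn1D_le R _ n.+1 y0.
  rewrite mulVKf// => yP.
  have -> : K ^+ 2 * harmonic n = n.+1%:R * (n.+1%:R^-1 * K) ^+ 2.
    by rewrite /harmonic/=; field; rewrite addrC natr1 pnatr_eq0.
  apply: le_trans (ler_wpM2l _ yP) => //.
  have SK : series (exp_coeff K) n.+2 <= expR K.
    apply: nondecreasing_cvgn_le; last exact: is_cvg_series_exp_coeff.
    by apply/nondecreasing_series => k _ _; exact: exp_coeff_ge0.
  apply: le_trans (ler_wpM2l _ (lerB SK (lexx _))) => //.
  (* Viewing [K] in the algebra [R^o] gives the real gap the same coefficients, so the comparison is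
     term by term. *)
  have := sum_exp_sub_exprn1D R _ (K : R^o) n.
  rewrite /series/= /exp_coeff/=; under eq_bigr do rewrite [_ *: _]mulrC.
  rewrite -[_ *: _]/(n.+1%:R^-1 * K) => ->.
  rewrite mulr_sumr; apply: ler_sum => i _.
  rewrite normrZ ger0_norm ?subr_ge0 ?bin_div_expn_le_invfact//.
  by rewrite [leRHS]mulrCA ler_wpM2l ?subr_ge0 ?bin_div_expn_le_invfact.
exact: cvg_cst.
Unshelve. all: by end_near. Qed.

Lemma trace_lmul_qX : depressed p -> \tr (lmul_mx ('qX : A)) = 0.
Proof.
case=> sp pm cp; have mp : mk_monic p = p by rewrite /mk_monic sp pm.
(* Diagonal entry [i] is the coefficient of degree [i] in ['X^(i.+1)] modulo [p]; only the last
   column involves a reduction. *)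
rewrite /mxtrace big1// => i _; rewrite mxE nth_powers -exprS coord_powersE.
rewrite /qpolyX -rmorphXn/= mp.
have [n spE] : exists n, size p = n.+2.
  by case: (size p) sp => [|[|n]]// _; exists n.
have id : (i <= n)%N by have := ltn_ord i; rewrite {2}/qdim mp spE.
rewrite spE /= in cp.
have [lt|ge] := ltnP i n.
  rewrite Pdiv.CommonRing.rmodp_small ?size_polyXn ?spE//.
  by rewrite coefXn ltn_eqF.
have {id ge}-> : i = n :> nat by apply/eqP; rewrite eqn_leq id.
have -> : 'X^(n.+1) = 1 * p + ('X^(n.+1) - p) by rewrite mul1r addrC subrK.
rewrite Pdiv.RingMonic.rmodp_addl_mul_small//.
  by rewrite coefB coefXn cp subr0 ltn_eqF.
rewrite spE ltnS; apply/leq_sizeP => j; rewrite leq_eqVlt => /orP[/eqP <-|nj].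
  have := monicP pm; rewrite lead_coefE spE /= => lp.
  by rewrite coefB coefXn eqxx lp subrr.
by rewrite coefB coefXn gtn_eqF// nth_default ?subr0// spE.
Qed.

Lemma pythag_1DZ_qX : depressed p -> exists2 C, 0 <= C &
  forall t, `|t| <= 1 -> `|pythag (1 + t *: ('qX : A)) - 1| <= C * t ^+ 2.
Proof.
move=> /trace_lmul_qX/det_1DZ_near1[C C0 CP]; exists C => // t t1.
by rewrite /pythag lmul_mx1DZ CP.
Qed.

End QuotientAlgebra.

Theorem theorem2p5 (R : realType) (p : {poly R}) (hp : depressed p)
    (theta : R) :
  pythag (qexp (theta *: ('qX : {poly %/ p}))) = 1.
Proof.
have [C C0 CP] := pythag_1DZ_qX hp.
have lim1 := cvg_pythag _ _ (cvg_exprn1D_qexp (theta *: ('qX : {poly %/ p}))).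
(* By uniqueness of limits it is enough that the same sequence tends to 1. *)
rewrite -(cvg_lim _ lim1)//; apply: cvg_lim => //.
under eq_fun do rewrite pythagX scalerA.
(* Here [t] is [harmonic n * theta], so [C * t ^+ 2] is this constant times [harmonic n ^+ 2];
   [|t| <= 1] holds for large [n]. *)
apply: (@cvg_exprn_near1 _ _ (C * theta ^+ 2)).
  by rewrite mulr_ge0 ?sqr_ge0.
have th0 : harmonic n * theta @[n --> \oo] --> (0 : R).
  by rewrite -[X in _ --> X](mul0r theta); apply: cvgMr_tmp; exact: cvg_harmonic.
near=> n.
rewrite -mulrA [theta ^+ 2 * _]mulrC -exprMn; apply: CP.
by near: n; exact: (cvgr0_norm_le _ th0).
Unshelve. all: by end_near. Qed.
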